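(* Let $d(k)$ denote the number of positive divisors of the positive integer $k$, let $T(q)=\sum_{k=1}^\infty d(k)\,q^k$ for $|q|<1$, and let $\gamma=0.57721\ldots$ be Euler's constant. Then for all real $q\in(0,1)$, $$\gamma\,\frac{q}{1-q}+\frac{\log(1-q)}{\log(q)}<T(q)<\frac{q}{1-q}+\frac{\log(1-q)}{\log(q)}.$$ Moreover the constants are best possible: if $\alpha,\beta$ are real constants such that $\alpha\,\frac{q}{1-q}+\frac{\log(1-q)}{\log(q)}<T(q)<\beta\,\frac{q}{1-q}+\frac{\log(1-q)}{\log(q)}$ for all $q\in(0,1)$, then $\alpha\le\gamma$ and $\beta\ge 1$.
   Context: $\log$ denotes the natural logarithm. *)

(* Defs.v *)
From Stdlib Require Import Reals.
From Coquelicot Require Import Coquelicot.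
From mathcomp Require prime.
Open Scope R_scope.

(* [prime.divisors k] is a duplicate-free list for k > 0; the value at k = 0
   is irrelevant, since the series below starts at k = 1. *)
Definition num_divisors (k : nat) : nat := length (prime.divisors k).

(* Sum over k >= 1 of d(k) q^k, reindexed by k = S n. *)
Definition T (q : R) : R :=
  Series (fun n : nat => INR (num_divisors (S n)) * q ^ S n).

Definition euler_gamma : R :=
  real (Lim_seq (fun n : nat =>
    sum_n_m (fun k : nat => / INR k) 1 n - ln (INR n))).

(* Main.v *)
(* Put q = exp (- t) and h x = 1 / (1 - exp (- x)) - 1 / x. The Lambert series
   of T and the logarithm series turn
     (T q - ln (1 - q) / ln q) / (q / (1 - q))
   into the average [excess t] of h over the points t, 2t, 3t, ... with
   geometric weights (1 - q) q^n. Since h < 1, so is the average, and h x >= 1 - 1 / x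
   makes it tend to 1 as q -> 0. Halving t splits each weight over two points
   (2n + 1) t / 2 < (n + 1) t; as h increases, excess (t / 2) < excess t.
   Finally 1 - h is decreasing with antiderivative ln x - ln (1 - exp (- x)),
   which lets t times the partial Lambert sums be compared with harmonic sums:
   with c = t q / (1 - q), gamma - (1 - c) <= c * excess t <= gamma. As c -> 1 for t -> 0,
   gamma is the infimum of the strictly decreasing sequence excess (t / 2^k). *)
Require Import Defs.
From Stdlib Require Import Reals Lra Lia.
From Coquelicot Require Import Coquelicot.
From mathcomp Require ssrbool ssrnat seq div prime.
Open Scope R_scope.

(** * Divisor counts and the Lambert series *)

(** The cutoff [N] is left free so that one square range of summation serves all [k <= N] when the
    order of summation is switched. *)
Lemma num_divisors_sum (k N : nat) : (k <= N)%nat ->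
  INR (num_divisors (S k)) =
  sum_n (fun i => if div.dvdn (S i) (S k) then 1 else 0) N.
Proof.
  intros Hk.
  set (p := fun i => div.dvdn i (S k)).
  assert (Hsum : forall M, INR (seq.count p (seq.iota 1 (S M))) =
                           sum_n (fun i => if p (S i) then 1 else 0) M).
  { induction M as [|M IH].
    - rewrite sum_O. simpl. destruct (p 1%nat); simpl; lra.
    - rewrite sum_Sn, <- IH.
      replace (seq.iota 1 (S (S M)))
        with (seq.cat (seq.iota 1 (S M)) (seq.iota (S (S M)) 1)).
      2:{ symmetry. replace (S (S M)) with (ssrnat.addn (S M) 1) at 1.
          - rewrite seq.iotaD. reflexivity.
          - now rewrite ssrnat.addn1. }
      rewrite seq.count_cat, <- ssrnat.plusE, plus_INR.
      unfold plus; cbn -[seq.iota p]. f_equal.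
      cbn -[p]. destruct (p (S (S M))); simpl; lra. }
  change (INR (num_divisors (S k)) = sum_n (fun i => if p (S i) then 1 else 0) N).
  rewrite <- Hsum, <- seq.size_filter.
  unfold num_divisors. f_equal.
  (* Both lists are duplicate-free, so equal membership makes them permutations of each other. *)
  apply (seq.perm_size (T := ssrnat.Datatypes_nat__canonical__eqtype_Equality)).
  apply seq.uniq_perm.
  - apply prime.divisors_uniq.
  - apply seq.filter_uniq, seq.iota_uniq.
  - intros x. rewrite <- prime.dvdn_divisors by reflexivity.
    rewrite seq.mem_filter, seq.mem_iota. unfold p.
    destruct (div.dvdn x (S k)) eqn:E; [|reflexivity].
    symmetry. apply andb_true_intro. split; [reflexivity|].
    apply andb_true_intro. split.
    + now apply (div.dvdn_gt0 (d := x) (m := S k)).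
    + apply ssrbool.introT with (1 := ssrnat.leP).
      apply div.dvdn_leq in E; [|reflexivity].
      apply (ssrbool.elimT ssrnat.leP) in E.
      rewrite <- ssrnat.plusE. lia.
Qed.

(** [d * m] is the first multiple of [d] beyond [N], and the right side is the closed form of q^d +
    q^(2d) + ... + q^(d(m-1)). *)
Lemma sum_multiples (q : R) (d N : nat) : 0 < q < 1 -> (0 < d)%nat ->
  exists m, (N < d * m <= N + d)%nat /\
    sum_n_m (fun k => if div.dvdn d k then q ^ k else 0) 1 N
      = (q ^ d - q ^ (d * m)) / (1 - q ^ d).
Proof.
  intros Hq Hd.
  assert (Hqd : q ^ d < 1) by (apply pow_lt_1_compat; lra || lia).
  induction N as [|N [m [Hm IH]]].
  - exists 1%nat. split; [lia|].
    rewrite sum_n_m_zero by lia. rewrite Nat.mul_1_r. unfold zero; simpl. field. lra.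
  - rewrite sum_n_Sm by lia. rewrite IH. unfold plus; simpl.
    destruct (Nat.eq_dec (d * m) (S N)) as [e|ne].
    + exists (S m). split; [lia|].
      replace (div.dvdn d (S N)) with true.
      2:{ symmetry. rewrite <- e. apply div.dvdn_mulr, div.dvdnn. }
      change (q * q ^ N) with (q ^ S N).
      replace (d * S m)%nat with (d + d * m)%nat by lia.
      rewrite pow_add, e. field. lra.
    + exists m. split; [lia|].
      replace (div.dvdn d (S N)) with false.
      (* Here [S N] lies strictly between the consecutive multiples d(m-1) and dm. *)
      2:{ symmetry. destruct (div.dvdn d (S N)) eqn:E; [|reflexivity].
          exfalso. apply (ssrbool.elimT div.dvdnP) in E. destruct E as [j Hj].
          rewrite <- ssrnat.multE in Hj.
          assert (j = m \/ (j < m \/ m < j))%nat as [->|[H|H]] by lia; nia. }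
      field. lra.
Qed.

(** Each term of 1 + r + ... + r^n = (1 - r^(n+1)) / (1 - r) is at least r^n. *)
Lemma mult_pow_le (r : R) (n : nat) : 0 < r < 1 ->
  INR (S n) * r ^ n * (1 - r) <= 1 - r ^ S n.
Proof.
  intros Hr. induction n as [|n IH].
  - simpl. lra.
  - rewrite S_INR.
    assert (H : r ^ S n <= 1).
    { rewrite <- (pow1 (S n)). apply pow_incr. lra. }
    replace (r ^ S (S n)) with (r * r ^ S n) by reflexivity.
    replace (r ^ S n) with (r * r ^ n) in * by reflexivity.
    nra.
Qed.

(* With r = sqrt q, n q^n = (n r^n) r^n is a bounded factor times a geometric one. *)
Lemma is_lim_seq_mult_pow (q : R) : 0 < q < 1 ->
  is_lim_seq (fun n => INR (S n) * q ^ S n) 0.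
Proof.
  intros Hq. set (r := sqrt q).
  assert (Hr : 0 < r) by (apply sqrt_lt_R0; lra).
  assert (Hrr : r * r = q) by (apply sqrt_sqrt; lra).
  assert (Hr1 : r < 1) by nra.
  apply is_lim_seq_le_le with (u := fun _ => 0) (w := fun n => / (1 - r) * r ^ n).
  - intros n. split.
    + apply Rmult_le_pos; [apply pos_INR | apply pow_le; lra].
    + pose proof (mult_pow_le r n (conj Hr Hr1)) as H.
      pose proof (pow_lt r n Hr) as Hp. pose proof (pow_lt r (S n) Hr) as Hp'.
      apply Rmult_le_reg_l with (1 - r); [lra|].
      rewrite <- (Rmult_assoc (1 - r) (/ (1 - r))), Rinv_r, Rmult_1_l by lra.
      assert (E : q ^ S n = r ^ S n * r ^ S n) by (rewrite <- Hrr; apply Rpow_mult_distr).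
      rewrite E. replace (r ^ S n) with (r * r ^ n) in * by reflexivity.
      set (p := r ^ n) in *. set (c := INR (S n)) in *.
      assert (c * p * (1 - r) <= 1) by nra.
      assert (p <= 1).
      { unfold p. rewrite <- (pow1 n). apply pow_incr. lra. }
      replace ((1 - r) * (c * (r * p * (r * p)))) with ((c * p * (1 - r)) * (p * (r * r))) by ring.
      assert (p * (r * r) <= p) by nra.
      assert (0 < p * (r * r)) by (apply Rmult_lt_0_compat; nra).
      nra.
  - apply is_lim_seq_const.
  - replace (Finite 0) with (Rbar_mult (/ (1 - r)) 0) by (simpl; f_equal; ring).
    apply is_lim_seq_scal_l, is_lim_seq_geom. rewrite Rabs_pos_eq; lra.
Qed.

Lemma ex_series_lambert (q : R) : 0 < q < 1 ->
  ex_series (fun n => q ^ S n / (1 - q ^ S n)).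
Proof.
  intros Hq.
  apply (ex_series_le (K := R_AbsRing) (V := R_CompleteNormedModule))
    with (b := fun n => / (1 - q) * q ^ n).
  - intros n.
    assert (Hn : 0 < q ^ n <= 1).
    { split; [apply pow_lt; lra|]. rewrite <- (pow1 n). apply pow_incr. lra. }
    change (q ^ S n) with (q * q ^ n).
    change (Rabs (q * q ^ n / (1 - q * q ^ n)) <= / (1 - q) * q ^ n).
    assert (Hd : 1 - q <= 1 - q * q ^ n) by nra.
    assert (/ (1 - q * q ^ n) <= / (1 - q)) by (apply Rinv_le_contravar; lra).
    assert (0 < / (1 - q * q ^ n)) by (apply Rinv_0_lt_compat; lra).
    rewrite Rabs_pos_eq.
    + unfold Rdiv. rewrite Rmult_comm. apply Rmult_le_compat; nra.
    + apply Rmult_le_pos; nra.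
  - apply (ex_series_scal (K := R_AbsRing) (V := R_NormedModule)).
    apply ex_series_geom. rewrite Rabs_pos_eq; lra.
Qed.

(** Summing q^k over the multiples of each divisor first gives geometric series. The switch is made
    on finite square sums, and the truncation error is squeezed to 0, so no double series arises. *)
Lemma T_lambert (q : R) : 0 < q < 1 ->
  T q = Series (fun n => q ^ S n / (1 - q ^ S n)).
Proof.
  intros Hq.
  pose proof (Series_correct _ (ex_series_lambert q Hq)) as HL.
  set (L := Series _) in *.
  apply is_series_unique.
  change (is_lim_seq (sum_n (fun n => INR (num_divisors (S n)) * q ^ S n)) L).
  change (is_lim_seq (sum_n (fun n => q ^ S n / (1 - q ^ S n))) L) in HL.
  assert (Hsw : forall N, sum_n (fun n => INR (num_divisors (S n)) * q ^ S n) N =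
    sum_n (fun i => sum_n_m (fun k => if div.dvdn (S i) k then q ^ k else 0) 1 (S N)) N).
  { intros N.
    transitivity (sum_n (fun k => sum_n (fun i => if div.dvdn (S i) (S k) then q ^ S k else 0) N) N).
    - apply sum_n_ext_loc. intros k Hk.
      rewrite (num_divisors_sum k N Hk), Rmult_comm.
      rewrite <- (sum_n_mult_l (K := R_AbsRing)). apply sum_n_ext. intros i.
      unfold mult; simpl. destruct (div.dvdn (S i) (S k)); ring.
    - rewrite sum_n_switch. apply sum_n_ext. intros i.
      unfold sum_n.
      exact (sum_n_m_S (fun k => if div.dvdn (S i) k then q ^ k else 0) 0 N). }
  (* Row i of the double sum, cut at k <= N + 1, misses at most q^(N+1) / (1 - q). *)
  apply is_lim_seq_le_le with
    (u := fun N => sum_n (fun n => q ^ S n / (1 - q ^ S n)) N - / (1 - q) * (INR (S N) * q ^ S N))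
    (w := sum_n (fun n => q ^ S n / (1 - q ^ S n))).
  - intros N. rewrite Hsw.
    assert (Hterm : forall i,
      q ^ S i / (1 - q ^ S i) - / (1 - q) * q ^ S N
        <= sum_n_m (fun k => if div.dvdn (S i) k then q ^ k else 0) 1 (S N)
        <= q ^ S i / (1 - q ^ S i)).
    { intros i.
      destruct (sum_multiples q (S i) (S N) Hq ltac:(lia)) as [m [Hm ->]].
      set (d := S i) in *.
      assert (Hd : 0 < q ^ d <= q).
      { split; [apply pow_lt; lra|]. unfold d; simpl.
        assert (q ^ i <= 1) by (rewrite <- (pow1 i); apply pow_incr; lra).
        nra. }
      assert (Hr : 0 < q ^ (d * m) <= q ^ S N).
      { split; [apply pow_lt; lra|].
        replace (d * m)%nat with (S N + (d * m - S N))%nat by lia.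
        rewrite pow_add. rewrite <- (Rmult_1_r (q ^ S N)) at 2.
        apply Rmult_le_compat_l; [apply pow_le; lra|].
        rewrite <- (pow1 (d * m - S N)). apply pow_incr; lra. }
      unfold Rdiv. rewrite Rmult_minus_distr_r.
      assert (/ (1 - q ^ d) <= / (1 - q)) by (apply Rinv_le_contravar; lra).
      assert (0 < / (1 - q ^ d)) by (apply Rinv_0_lt_compat; lra).
      split; nra. }
    split.
    + rewrite <- Rmult_assoc, (Rmult_comm _ (INR _)), Rmult_assoc, <- sum_n_const.
      apply Rle_trans with
        (sum_n (fun i => q ^ S i / (1 - q ^ S i) - / (1 - q) * q ^ S N) N).
      * right. clear. generalize (/ (1 - q) * q ^ S N); intros c.
        induction N as [|N IH].
        -- now rewrite !sum_O.
        -- rewrite !sum_Sn, <- IH. unfold plus; simpl. ring.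
      * apply sum_n_m_le. intros i. apply Hterm.
    + apply sum_n_m_le. intros i. apply Hterm.
  - replace (Finite L) with (Finite (L - / (1 - q) * 0)) by (f_equal; ring).
    apply is_lim_seq_minus'; [exact HL|].
    apply (is_lim_seq_scal_l _ (/ (1 - q)) 0), is_lim_seq_mult_pow, Hq.
  - exact HL.
Qed.

(** * The logarithm series *)

Lemma ln_series (q : R) : 0 < q < 1 ->
  is_series (fun n => q ^ S n / INR (S n)) (- ln (1 - q)).
Proof.
  intros Hq.
  assert (HR : CV_radius (fun _ : nat => 1) = 1).
  { rewrite (CV_radius_finite_DAlembert (fun _ => 1) 1).
    - f_equal. field.
    - intros _. lra.
    - lra.
    - apply is_lim_seq_ext with (u := fun _ => 1).
      + intros _. replace (1 / 1) with 1 by field. now rewrite Rabs_R1.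
      + apply is_lim_seq_const. }
  assert (Hin : Rbar_lt (Rabs q) (CV_radius (fun _ : nat => 1))).
  { rewrite HR, Rabs_pos_eq; simpl; lra. }
  pose proof (is_pseries_RInt _ _ Hin) as H.
  (* - ln (1 - x) is the integral of the geometric series. *)
  assert (HI : RInt (PSeries (fun _ => 1)) 0 q = - ln (1 - q)).
  { apply is_RInt_unique.
    replace (- ln (1 - q)) with (minus (- ln (1 - q)) (- ln (1 - 0))).
    2:{ rewrite Rminus_0_r, ln_1. unfold minus, plus, opp; simpl. ring. }
    apply is_RInt_ext with (f := fun x => / (1 - x)).
    - intros x Hx. rewrite Rmin_left, Rmax_right in Hx by lra.
      symmetry. apply is_series_unique.
      apply is_series_ext with (a := fun n => x ^ n); [intros n; symmetry; apply Rmult_1_l|].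
      apply is_series_geom. rewrite Rabs_pos_eq; lra.
    - apply (is_RInt_derive (V := R_CompleteNormedModule) (fun x => - ln (1 - x))); intros x Hx;
        rewrite Rmin_left, Rmax_right in Hx by lra.
      + auto_derive; [lra | field; lra].
      + apply (ex_derive_continuous (K := R_AbsRing) (V := R_NormedModule)).
        auto_derive. lra. }
  rewrite HI in H. apply is_pseries_R in H.
  apply is_series_ext with (a := fun n => PS_Int (fun _ => 1) (S n) * q ^ S n).
  - intros n. unfold PS_Int, Rdiv. rewrite Rmult_1_l. apply Rmult_comm.
  (* The zeroth coefficient of [PS_Int] is 0, so the index shift leaves the sum unchanged. *)
  - apply (is_series_incr_1 (fun n => PS_Int (fun _ => 1) n * q ^ n)).
    match goal with |- is_series _ ?l => replace l with (- ln (1 - q)) end; [exact H|].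
    unfold plus; simpl. ring.
Qed.

(** * Bounds and monotonicity of [h] *)

(** The kernel of the classical formula: gamma is the integral of h(x) e^(-x) over (0, oo). The
    averages [excess t] below behave like Riemann sums of it as t -> 0. *)
Definition h (x : R) : R := / (1 - exp (- x)) - / x.

(** All follow from [1 + y < exp y] at [y = x] and [y = - x], since [exp x * exp (- x) = 1]. *)
Lemma exp_opp_bounds (x : R) : 0 < x -> 1 - x < exp (- x) < 1 /\ (1 + x) * exp (- x) < 1.
Proof.
  intros Hx. pose proof (exp_pos (- x)).
  assert (H1 : exp x * exp (- x) = 1) by (rewrite <- exp_plus, <- exp_0; f_equal; ring).
  pose proof (exp_ineq1 x ltac:(lra)). pose proof (exp_ineq1 (- x) ltac:(lra)).
  repeat split; nra.
Qed.

Lemma h_bounds (x : R) : 0 < x -> 0 < h x < 1 /\ 1 - / x <= h x.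
Proof.
  intros Hx. destruct (exp_opp_bounds x Hx) as [[H1 H2] H3].
  pose proof (exp_pos (- x)). unfold h.
  assert (/ x < / (1 - exp (- x))) by (apply Rinv_lt_contravar; nra).
  assert (/ (1 - exp (- x)) < 1 + / x).
  { replace (1 + / x) with (/ (x / (1 + x))) by (field; lra).
    apply Rinv_lt_contravar.
    - apply Rmult_lt_0_compat; [apply Rdiv_lt_0_compat; lra | lra].
    - apply Rmult_lt_reg_r with (1 + x); [lra|].
      unfold Rdiv. rewrite Rmult_assoc, Rinv_l by lra. lra. }
  assert (1 < / (1 - exp (- x))).
  { rewrite <- Rinv_1 at 1. apply Rinv_lt_contravar; lra. }
  repeat split; lra.
Qed.

(** This is 2 sinh(x/2) > x, to which positivity of the derivative of [h] reduces. *)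
Lemma sinh_gt (x : R) : 0 < x -> x < exp (x / 2) - exp (- (x / 2)).
Proof.
  intros Hx.
  cut (exp (0 / 2) - exp (- (0 / 2)) - 0 < exp (x / 2) - exp (- (x / 2)) - x).
  { replace (0 / 2) with 0 by field. rewrite Ropp_0. lra. }
  destruct (MVT_cor2 (fun y => exp (y / 2) - exp (- (y / 2)) - y)
     (fun y => (exp (y / 2) + exp (- (y / 2))) / 2 - 1) 0 x Hx) as [c [E Hc]].
  - intros y _. apply is_derive_Reals. auto_derive; [auto | unfold Rdiv; field].
  - assert (H : 0 < (exp (c / 2) + exp (- (c / 2))) / 2 - 1).
    { assert (1 < exp (c / 2)) by (rewrite <- exp_0 at 1; apply exp_increasing; lra).
      rewrite exp_Ropp. set (e := exp (c / 2)) in *.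
      (* The derivative cosh(c/2) - 1 is a square divided by a positive number. *)
      replace ((e + / e) / 2 - 1) with ((e - 1) * (e - 1) * / (2 * e)) by (field; lra).
      repeat apply Rmult_lt_0_compat; try apply Rinv_0_lt_compat; lra. }
    assert (0 < x - 0) by lra. nra.
Qed.

(** With a = e^(-z/2), the derivative 1/z^2 - a^2/(1 - a^2)^2 is positive because z a < 1 - a^2,
    which is [sinh_gt] multiplied by a. *)
Lemma h_increasing (x y : R) : 0 < x -> x < y -> h x < h y.
Proof.
  intros Hx Hxy.
  apply (incr_function h 0 p_infty
    (fun x => / (x * x) - exp (- x) / ((1 - exp (- x)) * (1 - exp (- x))))); simpl; auto.
  - intros z Hz _. destruct (exp_opp_bounds z Hz) as [[H1 H2] _].
    unfold h. auto_derive; [repeat split; lra | field; lra].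
  - intros z Hz _. destruct (exp_opp_bounds z Hz) as [[H1 H2] _].
    pose proof (sinh_gt z Hz) as Hs.
    set (a := exp (- (z / 2))) in *.
    assert (Ha : 0 < a) by apply exp_pos.
    assert (E1 : exp (- z) = a * a) by (unfold a; rewrite <- exp_plus; f_equal; field).
    assert (E2 : exp (z / 2) = / a) by (unfold a; rewrite <- exp_Ropp; f_equal; ring).
    assert (H3 : z * a < 1 - a * a).
    { rewrite E2 in Hs. apply Rmult_lt_compat_r with (r := a) in Hs; [|exact Ha].
      rewrite Rmult_minus_distr_r, Rinv_l in Hs; lra. }
    rewrite E1 in *.
    replace (/ (z * z)) with (a * a * / ((z * a) * (z * a))) by (field; lra).
    unfold Rdiv. rewrite <- Rmult_minus_distr_l.
    apply Rmult_lt_0_compat; [nra|]. apply Rlt_0_minus.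
    apply Rinv_lt_contravar.
    + repeat apply Rmult_lt_0_compat; lra.
    + apply Rmult_gt_0_lt_compat; nra.
Qed.

Lemma h_le (x y : R) : 0 < x -> x <= y -> h x <= h y.
Proof.
  intros Hx [H| ->]; [left; now apply h_increasing | lra].
Qed.

(** * The weighted averages [excess t] *)

(* The excess of T q over ln (1 - q) / ln q at q = exp (- t), divided by q / (1 - q). *)
Definition excess (t : R) : R :=
  (1 - exp (- t)) * Series (fun n => h (INR (S n) * t) * exp (- t) ^ n).

Lemma exp_opp_pow (t : R) (n : nat) : exp (- t) ^ n = exp (- (INR n * t)).
Proof.
  induction n as [|n IH].
  - simpl. now rewrite Rmult_0_l, Ropp_0, exp_0.
  - rewrite S_INR. simpl. rewrite IH, <- exp_plus. f_equal. ring.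
Qed.

Lemma INR_S_mult_pos (t : R) (n : nat) : 0 < t -> 0 < INR (S n) * t.
Proof. intros Ht. apply Rmult_lt_0_compat; [apply lt_0_INR; lia | exact Ht]. Qed.

Lemma ex_series_bounded_geom (a : nat -> R) (q : R) : 0 < q < 1 ->
  (forall n, Rabs (a n) <= 1) -> ex_series (fun n => a n * q ^ n).
Proof.
  intros Hq Ha.
  apply (ex_series_le (K := R_AbsRing) (V := R_CompleteNormedModule))
    with (b := fun n => q ^ n).
  - intros n. change (Rabs (a n * q ^ n) <= q ^ n).
    assert (0 < q ^ n) by (apply pow_lt; lra).
    rewrite Rabs_mult, (Rabs_pos_eq (q ^ n)) by lra.
    specialize (Ha n). nra.
  - apply ex_series_geom. rewrite Rabs_pos_eq; lra.
Qed.

(** Strictness comes from the first term; the tails are compared weakly. *)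
Lemma Series_lt (a b : nat -> R) : ex_series a -> ex_series b ->
  (forall n, a n < b n) -> Series a < Series b.
Proof.
  intros Ha Hb H.
  cut (0 < Series (fun n => b n - a n)).
  { rewrite (Series_minus b a Hb Ha). lra. }
  assert (Hd : ex_series (fun n => b n - a n)) by exact (ex_series_minus b a Hb Ha).
  rewrite (Series_incr_1 _ Hd).
  assert (0 <= Series (fun k => b (S k) - a (S k))).
  { apply Rle_trans with (Series (fun _ => 0)).
    - rewrite (Series_ext _ (fun _ => 0 * 0)) by (intros n; symmetry; apply Rmult_0_l).
      rewrite Series_scal_l. lra.
    - apply Series_le.
      + intros n. specialize (H (S n)). lra.
      + exact (proj1 (ex_series_incr_1 (K := R_AbsRing) (V := R_NormedModule) _) Hd). }
  specialize (H 0%nat). lra.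
Qed.

Lemma exp_opp_in (t : R) : 0 < t -> 0 < exp (- t) < 1.
Proof. intros Ht. split; [apply exp_pos | apply exp_opp_bounds, Ht]. Qed.

Lemma ex_series_excess (t : R) : 0 < t ->
  ex_series (fun n => h (INR (S n) * t) * exp (- t) ^ n).
Proof.
  intros Ht. apply (ex_series_bounded_geom (fun n => h (INR (S n) * t))).
  - now apply exp_opp_in.
  - intros n. destruct (h_bounds _ (INR_S_mult_pos t n Ht)) as [[H1 H2] _].
    rewrite Rabs_pos_eq; lra.
Qed.

(** At x = (n+1) t the Lambert term is q q^n (h(x) + 1/x). The parts with 1/x sum to - ln(1 - q) /
    t, and [ln q = - t]. *)
Lemma T_excess (t : R) : 0 < t ->
  let q := exp (- t) in
  T q = q / (1 - q) * excess t + ln (1 - q) / ln q.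
Proof.
  intros Ht q. pose proof (exp_opp_in t Ht) as Hq. fold q in Hq.
  unfold excess. fold q.
  pose proof (ln_series q Hq) as HL.
  replace (q / (1 - q) * ((1 - q) * Series (fun n => h (INR (S n) * t) * q ^ n)))
    with (q * Series (fun n => h (INR (S n) * t) * q ^ n)) by (field; lra).
  replace (ln (1 - q) / ln q) with (/ t * - ln (1 - q))
    by (replace (ln q) with (- t) by (unfold q; now rewrite ln_exp); field; lra).
  rewrite <- (is_series_unique _ _ HL), <- !Series_scal_l.
  rewrite <- Series_plus.
  - rewrite (T_lambert q Hq). apply Series_ext. intros n.
    pose proof (INR_S_mult_pos t n Ht) as Hn.
    destruct (exp_opp_in _ Hn) as [H1 H2].
    unfold h. rewrite <- exp_opp_pow in *. fold q in H1, H2 |- *.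
    change (q ^ S n) with (q * q ^ n) in *.
    assert (INR (S n) <> 0) by (apply not_0_INR; lia).
    set (c := INR (S n)) in *. set (p := q ^ n) in *. field. repeat split; lra.
  - exact (ex_series_scal (K := R_AbsRing) (V := R_NormedModule) q _ (ex_series_excess t Ht)).
  - apply (ex_series_scal (K := R_AbsRing) (V := R_NormedModule) (/ t)).
    now exists (- ln (1 - q)).
Qed.

(** The weights (1 - q) q^n have total mass 1, so bounds on [h] pass to its averages. *)
Lemma Series_geom_1 (c q : R) : 0 < q < 1 -> (1 - q) * Series (fun n => c * q ^ n) = c.
Proof.
  intros Hq. rewrite Series_scal_l, Series_geom by (rewrite Rabs_pos_eq; lra). field. lra.
Qed.

Lemma excess_lt_1 (t : R) : 0 < t -> excess t < 1.
Proof.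
  intros Ht. pose proof (exp_opp_in t Ht) as Hq.
  unfold excess.
  apply Rlt_le_trans with (2 := Req_le _ _ (Series_geom_1 1 (exp (- t)) Hq)).
  apply Rmult_lt_compat_l; [lra|].
  apply Series_lt.
  - now apply ex_series_excess.
  - apply (ex_series_bounded_geom (fun _ => 1)); [exact Hq|]. intros _. rewrite Rabs_R1. lra.
  - intros n. apply Rmult_lt_compat_r; [apply pow_lt; lra|].
    now apply h_bounds, INR_S_mult_pos.
Qed.

Lemma excess_ge_h (t : R) : 0 < t -> h t <= excess t.
Proof.
  intros Ht. pose proof (exp_opp_in t Ht) as Hq.
  unfold excess. rewrite <- (Series_geom_1 (h t) (exp (- t)) Hq) at 1.
  apply Rmult_le_compat_l; [lra|].
  apply Series_le; [|now apply ex_series_excess].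
  intros n. assert (0 < exp (- t) ^ n) by (apply pow_lt; lra).
  destruct (h_bounds t Ht) as [[H1 _] _].
  split; [nra|]. apply Rmult_le_compat_r; [lra|].
  apply h_le; [exact Ht|]. rewrite S_INR. pose proof (pos_INR n). nra.
Qed.

Lemma excess_half_lt (t : R) : 0 < t -> excess (t / 2) < excess t.
Proof.
  intros Ht. set (s := t / 2). assert (Hs : 0 < s) by (unfold s; lra).
  pose proof (exp_opp_in t Ht) as Hq. pose proof (exp_opp_in s Hs) as Hr.
  unfold excess.
  set (q := exp (- t)) in *. set (r := exp (- s)) in *.
  assert (E : q = r ^ 2).
  { unfold q, r, s. simpl. rewrite Rmult_1_r, <- exp_plus. f_equal. field. }
  set (a := fun n => h (INR (S n) * s)).
  set (b := fun n => h (INR (S n) * t)).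
  assert (Ha : forall n, 0 < a n < 1).
  { intros n. now apply h_bounds, INR_S_mult_pos. }
  assert (Hex : forall f : nat -> nat, ex_series (fun n => a (f n) * q ^ n)).
  { intros f. apply (ex_series_bounded_geom (fun n => a (f n))); [exact Hq|].
    intros n. rewrite Rabs_pos_eq; specialize (Ha (f n)); lra. }
  (* Index 2n+1 of [a] stands for the point (2n+2) s = (n+1) t. *)
  assert (Hodd : forall n, a (2 * n + 1)%nat = b n).
  { intros n. unfold a, b, s. f_equal.
    replace (S (2 * n + 1)) with (2 * S n)%nat by lia.
    rewrite mult_INR. simpl (INR 2). field. }
  assert (Heven : forall n, a (2 * n)%nat < b n).
  { intros n. rewrite <- Hodd. apply h_increasing; [now apply INR_S_mult_pos|].
    apply Rmult_lt_compat_r; [exact Hs|]. apply lt_INR. lia. }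
  (* Let A and B be the even and odd parts of [a], as power series in q = r^2. B is the series of
     [b] and A < B, hence (1 - r)(A + r B) < (1 - r)(1 + r) B = (1 - q) B. *)
  change ((1 - r) * PSeries a r < (1 - q) * PSeries b q).
  rewrite PSeries_odd_even, <- E.
  2,3: rewrite <- E; apply ex_pseries_R.
  2: apply (Hex (fun n => 2 * n)%nat).
  2: apply (Hex (fun n => 2 * n + 1)%nat).
  rewrite (PSeries_ext (fun n => a (2 * n + 1)%nat) b q Hodd).
  assert (PSeries (fun n => a (2 * n)%nat) q < PSeries b q).
  { apply Series_lt.
    - apply (Hex (fun n => 2 * n)%nat).
    - now apply ex_series_excess.
    - intros n. apply Rmult_lt_compat_r; [apply pow_lt; lra | apply Heven]. }
  rewrite E at 3. nra.
Qed.

(** * Logarithm inequalities and Euler's constant *)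

Lemma ln_le_sub_1 (x : R) : 0 < x -> ln x <= x - 1.
Proof.
  intros Hx. destruct (Req_dec (ln x) 0) as [E|E].
  - rewrite E, <- (exp_ln x Hx), E, exp_0. lra.
  - pose proof (exp_ineq1 (ln x) E). rewrite exp_ln in H by exact Hx. lra.
Qed.

Lemma ln_S_sub_bounds (n : nat) :
  / INR (S (S n)) <= ln (INR (S (S n))) - ln (INR (S n)) <= / INR (S n).
Proof.
  assert (Hn : 0 < INR (S n)) by (apply lt_0_INR; lia).
  rewrite (S_INR (S n)). set (x := INR (S n)) in *.
  rewrite <- ln_div by lra. split.
  - pose proof (ln_le_sub_1 (x / (x + 1)) ltac:(apply Rdiv_lt_0_compat; lra)) as H.
    rewrite ln_div in H |- * by lra.
    replace (/ (x + 1)) with (- (x / (x + 1) - 1)) by (field; lra). lra.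
  - pose proof (ln_le_sub_1 ((x + 1) / x) ltac:(apply Rdiv_lt_0_compat; lra)) as H.
    replace (/ x) with ((x + 1) / x - 1) by (field; lra). lra.
Qed.

(** The extra term [/ INR (S n)] carries the induction: it pays for the next increment of the
    logarithm. *)
Lemma harmonic_ge_ln (n : nat) :
  ln (INR (S n)) + / INR (S n) <= sum_n_m (fun k => / INR k) 1 (S n).
Proof.
  induction n as [|n IH].
  - rewrite sum_n_n. simpl. rewrite ln_1, Rinv_1. lra.
  - rewrite sum_n_Sm by lia. pose proof (ln_S_sub_bounds n) as H.
    unfold plus; cbn -[INR sum_n_m]. lra.
Qed.

(** [Lim_seq] is total, so convergence has to be shown: the sequence decreases and is bounded below
    by 0. Starting at 1 avoids [ln 0]. *)
Lemma euler_gamma_lim :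
  is_lim_seq (fun n => sum_n_m (fun k => / INR k) 1 (S n) - ln (INR (S n))) euler_gamma.
Proof.
  unfold euler_gamma.
  rewrite <- Lim_seq_incr_1.
  apply Lim_seq_correct'.
  apply ex_finite_lim_seq_decr with 0.
  - intros n. rewrite (sum_n_Sm _ 1 (S n)) by lia.
    pose proof (ln_S_sub_bounds n). unfold plus; cbn -[INR sum_n_m]. lra.
  - intros n. pose proof (harmonic_ge_ln n).
    assert (0 < / INR (S n)) by (apply Rinv_0_lt_compat, lt_0_INR; lia). lra.
Qed.

(** Makes every [alpha > euler_gamma] positive, so that the sharpness argument can divide by
    [alpha]. *)
Lemma euler_gamma_ge_0 : 0 <= euler_gamma.
Proof.
  apply (is_lim_seq_le (fun _ => 0) _ 0 euler_gamma) with (3 := euler_gamma_lim).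
  - intros n. pose proof (harmonic_ge_ln n).
    assert (0 < / INR (S n)) by (apply Rinv_0_lt_compat, lt_0_INR; lia). lra.
  - apply is_lim_seq_const.
Qed.

(** * Comparison of Lambert sums with harmonic sums *)

(** The antiderivative of [1 - h] that tends to 0 at 0. *)
Definition W (x : R) : R := ln x - ln (1 - exp (- x)).

Lemma W_sub_bounds (x y : R) : 0 < x < y ->
  (y - x) * (1 - h y) <= W y - W x <= (y - x) * (1 - h x).
Proof.
  intros Hxy.
  destruct (MVT_cor2 W (fun z => 1 - h z) x y) as [c [E Hc]]; [lra| |].
  - intros z Hz. destruct (exp_opp_in z ltac:(lra)) as [H1 H2].
    apply is_derive_Reals. unfold W, h.
    auto_derive; [repeat split; lra | field; lra].
  - rewrite E, (Rmult_comm (1 - h c)).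
    pose proof (h_le x c ltac:(lra) ltac:(lra)). pose proof (h_le c y ltac:(lra) ltac:(lra)).
    split; apply Rmult_le_compat_l; lra.
Qed.

(** Integral comparison for the decreasing function [1 - h]: from below over [t, (n+2) t], from
    above over [t, (n+1) t] with the first term kept apart, so that the singular formula at 0 is
    avoided. *)
Lemma sum_h_bounds (t : R) (n : nat) : 0 < t ->
  W (INR (S (S n)) * t) - W t
    <= sum_n (fun k => t * (1 - h (INR (S k) * t))) n
    <= t * (1 - h t) + W (INR (S n) * t) - W t.
Proof.
  intros Ht.
  assert (Hstep : forall k, 0 < INR (S k) * t < INR (S (S k)) * t /\
    INR (S (S k)) * t - INR (S k) * t = t).
  { intros k. pose proof (INR_S_mult_pos t k Ht). rewrite (S_INR (S k)). lra. }
  induction n as [|n IH].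
  - rewrite sum_O. destruct (Hstep 0%nat) as [H E].
    pose proof (W_sub_bounds _ _ H) as HW. rewrite E in HW.
    simpl (INR 1) in *. rewrite Rmult_1_l in *. lra.
  - rewrite sum_Sn.
    destruct (Hstep n) as [H1 E1]. destruct (Hstep (S n)) as [H2 E2].
    pose proof (W_sub_bounds _ _ H1) as HW1. pose proof (W_sub_bounds _ _ H2) as HW2.
    rewrite E1 in HW1. rewrite E2 in HW2. unfold plus; cbn -[INR sum_n]. lra.
Qed.

(** Termwise t q^k / (1 - q^k) = 1/k - t (1 - h(kt)). The sum of the last part is bounded through
    [W], where [ln t] cancels. *)
Lemma partial_lambert_bounds (t : R) (n : nat) : 0 < t ->
  let q := exp (- t) in
  let a := sum_n_m (fun k => / INR k) 1 (S n) - ln (INR (S n)) in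
  a - t * (1 - h t) + ln (1 - q ^ S n) - ln (1 - q)
    <= t * sum_n (fun k => q ^ S k / (1 - q ^ S k)) n
    <= a - ln (1 - q).
Proof.
  intros Ht q a. pose proof (exp_opp_in t Ht) as Hq. fold q in Hq.
  assert (E : t * sum_n (fun k => q ^ S k / (1 - q ^ S k)) n =
    sum_n_m (fun k => / INR k) 1 (S n) - sum_n (fun k => t * (1 - h (INR (S k) * t))) n).
  { rewrite <- sum_n_m_S. change (sum_n_m (fun k => / INR (S k)) 0 n) with (sum_n (fun k => / INR (S k)) n).
    assert (Hk : forall k, t * (q ^ S k / (1 - q ^ S k)) = / INR (S k) - t * (1 - h (INR (S k) * t))).
    { intros k. pose proof (exp_opp_in _ (INR_S_mult_pos t k Ht)).
      unfold h. unfold q. rewrite exp_opp_pow.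
      assert (INR (S k) <> 0) by (apply not_0_INR; lia).
      set (c := INR (S k)) in *. field. repeat split; lra. }
    clear a. induction n as [|n IH].
    - rewrite !sum_O. apply Hk.
    - rewrite !sum_Sn. unfold plus; cbn -[INR sum_n pow].
      rewrite Rmult_plus_distr_l, IH, Hk. ring. }
  rewrite E. pose proof (sum_h_bounds t n Ht) as H.
  assert (HW : forall k, W (INR (S k) * t) = ln (INR (S k)) + ln t - ln (1 - q ^ S k)).
  { intros k. unfold W, q. rewrite <- exp_opp_pow, ln_mult; [reflexivity | | exact Ht].
    apply lt_0_INR; lia. }
  rewrite !HW in H. unfold W in H. fold q in H. unfold a.
  (* The upper bound involves [W] at (n+2) t; these two estimates reduce it to the [ln (INR (S n))]
     inside [a]. *)
  assert (ln (1 - q ^ S (S n)) <= 0).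
  { assert (0 < q ^ S (S n) < 1).
    { split; [apply pow_lt; lra | apply pow_lt_1_compat; lra || lia]. }
    pose proof (ln_le_sub_1 (1 - q ^ S (S n)) ltac:(lra)). lra. }
  assert (ln (INR (S n)) <= ln (INR (S (S n)))).
  { apply ln_le; [apply lt_0_INR; lia | apply le_INR; lia]. }
  lra.
Qed.

(** Since [ln q = - t], c times the excess is t T(q) + ln(1 - q). The partial bounds pass to the
    limit n -> oo, and their error t (1 - h t) equals 1 - c. *)
Lemma excess_euler_gamma (t : R) : 0 < t ->
  let c := t * (exp (- t) / (1 - exp (- t))) in
  euler_gamma - (1 - c) <= c * excess t <= euler_gamma.
Proof.
  intros Ht. set (q := exp (- t)). intros c.
  pose proof (exp_opp_in t Ht) as Hq. fold q in Hq.
  pose proof (T_excess t Ht) as HT. cbv zeta in HT. fold q in HT.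
  assert (Ec : c * excess t = t * T q + ln (1 - q)).
  { rewrite HT. unfold c. replace (ln q) with (- t) by (unfold q; now rewrite ln_exp). field. lra. }
  assert (Hv : t * (1 - h t) = 1 - c) by (unfold c, h; fold q; field; lra).
  pose proof (Series_correct _ (ex_series_lambert q Hq)) as HL.
  rewrite <- (T_lambert q Hq) in HL.
  change (is_lim_seq (sum_n (fun n => q ^ S n / (1 - q ^ S n))) (T q)) in HL.
  apply (is_lim_seq_scal_l _ t) in HL.
  assert (Hln : is_lim_seq (fun n => ln (1 - q ^ S n)) 0).
  { replace (Finite 0) with (Finite (ln (1 - 0))) by now rewrite Rminus_0_r, ln_1.
    apply (is_lim_seq_continuous (fun x => ln (1 - x)) (fun n => q ^ S n) 0).
    - apply continuity_pt_filterlim.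
      apply (ex_derive_continuous (K := R_AbsRing) (V := R_NormedModule)
               (fun x => ln (1 - x))). auto_derive. lra.
    - apply (is_lim_seq_incr_1 (fun n => q ^ n)), is_lim_seq_geom. rewrite Rabs_pos_eq; lra. }
  rewrite Ec, <- Hv. pose proof euler_gamma_lim as Hg. split.
  - cut (euler_gamma - t * (1 - h t) + 0 - ln (1 - q) <= t * T q); [lra|].
    refine (is_lim_seq_le _ _ (Finite _) (Finite _)
              (fun n => proj1 (partial_lambert_bounds t n Ht)) _ HL).
    apply is_lim_seq_minus'; [|apply is_lim_seq_const].
    apply is_lim_seq_plus'; [|exact Hln].
    apply is_lim_seq_minus'; [exact Hg | apply is_lim_seq_const].
  - cut (t * T q <= euler_gamma - ln (1 - q)); [lra|].
    refine (is_lim_seq_le _ _ (Finite _) (Finite _)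
              (fun n => proj2 (partial_lambert_bounds t n Ht)) HL _).
    apply is_lim_seq_minus'; [exact Hg | apply is_lim_seq_const].
Qed.

(** * The limit t -> 0 and the sharp bounds *)

(** The middle term is t / (e^t - 1). Cleared of denominators, the bounds read 1 - t < q and (1 + t)
    q < 1. *)
Lemma mult_bose_bounds (t : R) : 0 < t -> 1 - t < t * (exp (- t) / (1 - exp (- t))) < 1.
Proof.
  intros Ht. pose proof (exp_opp_bounds t Ht) as [[H1 H2] H3].
  pose proof (exp_pos (- t)). set (q := exp (- t)) in *.
  replace (t * (q / (1 - q))) with (t * q / (1 - q)) by (field; lra).
  split; apply Rmult_lt_reg_r with (1 - q); try lra;
    (replace (t * q / (1 - q) * (1 - q)) with (t * q) by (field; lra)); nra.
Qed.

Lemma excess_pos (t : R) : 0 < t -> 0 < excess t.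
Proof.
  intros Ht. pose proof (excess_ge_h t Ht). pose proof (h_bounds t Ht). lra.
Qed.

Lemma excess_halving (t : R) (n : nat) : 0 < t -> excess (t / 2 ^ n) <= excess t.
Proof.
  intros Ht. induction n as [|n IH].
  - simpl. rewrite Rdiv_1_r. lra.
  - assert (H : 0 < 2 ^ n) by (apply pow_lt; lra).
    replace (t / 2 ^ S n) with (t / 2 ^ n / 2) by (simpl; field; lra).
    pose proof (excess_half_lt (t / 2 ^ n) ltac:(apply Rdiv_lt_0_compat; lra)). lra.
Qed.

Lemma euler_gamma_lt_excess (t : R) : 0 < t -> euler_gamma < excess t.
Proof.
  (* One halving supplies strictness, as the limit argument yields only a weak inequality at t/2. *)
  intros Ht. apply Rle_lt_trans with (2 := excess_half_lt t Ht).
  set (s := t / 2). assert (Hs : 0 < s) by (unfold s; lra).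
  (* With u = s / 2^n: gamma <= c excess(u) + (1 - c) <= excess(u) + u <= excess(s) + u. *)
  assert (H : forall n, euler_gamma <= excess s + s * (/ 2) ^ n).
  { intros n. assert (Hp : 0 < 2 ^ n) by (apply pow_lt; lra).
    rewrite pow_inv. change (s * / 2 ^ n) with (s / 2 ^ n).
    pose proof (excess_halving s n Hs) as Hh.
    assert (Hsn : 0 < s / 2 ^ n) by (apply Rdiv_lt_0_compat; lra).
    pose proof (excess_euler_gamma _ Hsn) as Hg. cbv zeta in Hg.
    pose proof (mult_bose_bounds _ Hsn) as Hc. pose proof (excess_pos _ Hsn).
    set (u := s / 2 ^ n) in *. set (c := u * _) in *. nra. }
  replace (excess s) with (excess s + s * 0) by ring.
  refine (is_lim_seq_le _ _ (Finite _) (Finite _) H (is_lim_seq_const _) _).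
  apply is_lim_seq_plus'; [apply is_lim_seq_const|].
  apply (is_lim_seq_scal_l _ s 0), is_lim_seq_geom. rewrite Rabs_pos_eq; lra.
Qed.

Theorem theorem4p1 :
  (forall q : R, 0 < q < 1 ->
     euler_gamma * (q / (1 - q)) + ln (1 - q) / ln q < T q /\
     T q < q / (1 - q) + ln (1 - q) / ln q)
  /\
  (forall alpha beta : R,
     (forall q : R, 0 < q < 1 ->
        alpha * (q / (1 - q)) + ln (1 - q) / ln q < T q /\
        T q < beta * (q / (1 - q)) + ln (1 - q) / ln q) ->
     alpha <= euler_gamma /\ beta >= 1).
Proof.
  split.
  - intros q Hq.
    assert (Ht : 0 < - ln q).
    { pose proof (ln_le_sub_1 q (proj1 Hq)). lra. }
    pose proof (T_excess _ Ht) as HT. cbv zeta in HT.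
    rewrite Ropp_involutive, exp_ln in HT by apply Hq.
    assert (0 < q / (1 - q)) by (apply Rdiv_lt_0_compat; lra).
    pose proof (euler_gamma_lt_excess _ Ht). pose proof (excess_lt_1 _ Ht).
    rewrite HT. split; nra.
  - intros alpha beta H.
    (* Division by q / (1 - q) turns the assumed bounds into bounds on the excess. *)
    assert (Hab : forall t, 0 < t -> alpha < excess t < beta).
    { intros t Ht. pose proof (exp_opp_in t Ht) as Hq.
      assert (0 < exp (- t) / (1 - exp (- t))) by (apply Rdiv_lt_0_compat; lra).
      specialize (H _ Hq). rewrite (T_excess t Ht) in H. split; nra. }
    split.
    + apply Rnot_lt_le. intros Hlt. pose proof euler_gamma_ge_0 as Hg.
      (* This t makes (1 - t) alpha = (alpha + gamma) / 2 > gamma, whereas (1 - t) alpha <= c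
         excess(t) <= gamma. *)
      assert (Ht : 0 < (alpha - euler_gamma) / (2 * alpha)) by (apply Rdiv_lt_0_compat; lra).
      pose proof (Hab _ Ht) as Ha. pose proof (excess_euler_gamma _ Ht) as He.
      cbv zeta in He. pose proof (mult_bose_bounds _ Ht) as Hc.
      set (t := (alpha - euler_gamma) / (2 * alpha)) in *.
      assert (E : alpha * t = (alpha - euler_gamma) / 2) by (unfold t; field; lra).
      set (c := t * _) in *. pose proof (excess_pos _ Ht).
      assert ((1 - t) * alpha <= c * excess t).
      { assert (t <= 1) by nra. apply Rmult_le_compat; lra. }
      lra.
    + apply Rnot_lt_ge. intros Hlt.
      (* At t = 1 / (1 - beta) the bound 1 - 1/t <= h(t) reads beta <= h(t) <= excess(t), against
         excess(t) < beta. *)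
      assert (Ht : 0 < / (1 - beta)) by (apply Rinv_0_lt_compat; lra).
      pose proof (Hab _ Ht). pose proof (excess_ge_h _ Ht).
      pose proof (h_bounds _ Ht) as [_ Hh]. rewrite Rinv_inv in Hh. lra.
Qed.
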